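(* Let $G$ be a finite graph (all of whose components are plain). For every integer $n$, $$M(G\times P_{-n-2})=M(G^*\times P_n).$$ In particular, writing $G(m,n)=P_m\times P_n$ and $G^*(m,n)=P_m^*\times P_n$, for every $m\ge 1$ and every integer $n$, $$M(G(m,-n-2))=M(G^*(m,n)).$$
   Context: Signed graphs. A signed graph is a finite graph in which each vertex is of one of three kinds: plain (weight $1$), anti-vertex (weight $-1$), or empty vertex (weight $0$); and each edge is of one of three kinds: plain vertical edge or ''vedge'' (weight $1$), anti-vedge (weight $-1$), or horizontal edge or ''hedge'' (weight $1$). A signed matching of a signed graph is a set of pairwise non-adjacent edges together with all the vertices not incident with any of those edges; its weight is the product of the weights of all the edges and vertices it contains (empty product $=1$). So a signed matching of nonzero weight must cover every empty vertex by an edge. $M(\Gamma)$ denotes the sum of the weights of all signed matchings of the signed graph $\Gamma$. Conjugation. $\Gamma^*$ is obtained from $\Gamma$ by interchanging plain vertices with anti-vertices and vedges with anti-vedges, leaving hedges and empty vertices alone; so $\Gamma^{**}=\Gamma$. Generalized rectangles. Let $G$ be a finite graph, its vertices regarded as plain vertices and its edges as plain vedges. Let $K$ be $G$ or $G^*$. For $n>0$, $K\times P_n$ consists of $n$ copies of $K$ lined up side by side from left to right, every vertex of a copy being joined by a hedge to its image in each neighbouring copy. For $n>0$, $K\times P_{-n}$ is $K^*\times P_n$ together with, for each vertex $v$ of $K$, one empty vertex on the left joined by a hedge to the image of $v$ in the leftmost copy of $K^*$, and one empty vertex on the right joined by a hedge to the image of $v$ in the rightmost copy of $K^*$ (and to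 nothing else). $K\times P_0$ consists, for each vertex $v$ of $K$, of two empty vertices joined to each other by a hedge. $P_m$ is the path graph with $m$ vertices, so $G(m,n)$ is the $m$ by $n$ grid graph when $n>0$, and $G^*(m,n)$ is the conjugate of $G(m,n)$. *)

(* Defs.v *)
(* Mathematical Components *)
From mathcomp Require Import all_boot all_order all_algebra.

Set Implicit Arguments.
Unset Strict Implicit.
Unset Printing Implicit Defensive.

Import GRing.Theory.
Local Open Scope ring_scope.

(* Finite graphs are loopless; parallel edges are allowed. *)
Record graph := Graph {
  vert : finType;
  edge : finType;
  ends : edge -> {set vert};
  card_ends : forall e, #|ends e| = 2%N
}.

Inductive vkind := Plain | Anti | Empty.
Inductive ekind := Vedge | AntiVedge | Hedge.

Definition vweight (k : vkind) : int :=
  match k with Plain => 1 | Anti => -1 | Empty => 0 end.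

Definition eweight (k : ekind) : int :=
  match k with Vedge => 1 | AntiVedge => -1 | Hedge => 1 end.

Record sgraph := SGraph {
  sg_graph :> graph;
  vkind_of : vert sg_graph -> vkind;
  ekind_of : edge sg_graph -> ekind
}.

Definition plain (G : graph) : sgraph :=
  @SGraph G (fun=> Plain) (fun=> Vedge).

Definition sconj (S : sgraph) : sgraph :=
  @SGraph S
    (fun v => match vkind_of v with
              | Plain => Anti | Anti => Plain | Empty => Empty end)
    (fun e => match ekind_of e with
              | Vedge => AntiVedge | AntiVedge => Vedge | Hedge => Hedge end).

(* A signed matching is encoded by its set of edges F, which determines the
   vertices that it contains. *)
Definition matching (G : graph) (F : {set edge G}) : bool :=
  [forall e in F, forall f in F, (e != f) ==> [disjoint ends e & ends f]].

Definition uncovered (G : graph) (F : {set edge G}) : {set vert G} :=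
  [set v | [forall e in F, v \notin ends e]].

Definition weight (S : sgraph) (F : {set edge S}) : int :=
  (\prod_(e in F) eweight (ekind_of e)) *
  (\prod_(v in uncovered F) vweight (vkind_of v)).

Definition M (S : sgraph) : int :=
  \sum_(F : {set edge S} | matching F) weight F.

Section Path.
Variable m : nat.

Definition path_ends (i : 'I_m.-1) : {set 'I_m} :=
  [set j : 'I_m | (j == i :> nat) || (j == i.+1 :> nat)].

Lemma card_path_ends i : #|path_ends i| = 2%N.
Proof.
have lt1 : (i.+1 < m)%N by case: m i => [|k] [].
have -> : path_ends i = [set Ordinal (ltnW lt1); Ordinal lt1].
  by apply/setP=> j; rewrite !inE -!val_eqE.
by rewrite cards2 -val_eqE /= neq_ltn ltnSn.
Qed.

Definition path_graph : graph := Graph card_path_ends.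

End Path.

Section Pos.
Variables (K : sgraph) (n : nat).

Definition pos_vert : finType := (vert K * 'I_n)%type.
Definition pos_edge : finType :=
  (edge K * 'I_n + vert K * edge (path_graph n))%type.

Definition pos_ends (e : pos_edge) : {set pos_vert} :=
  match e with
  | inl (e, i) => [set (v, i) | v in ends e]
  | inr (v, f) => [set (v, i) | i in ends f]
  end.

Lemma card_pos_ends e : #|pos_ends e| = 2%N.
Proof.
by case: e => [] [a b]; rewrite /= card_imset ?card_ends ?card_path_ends // => x y [].
Qed.

Definition prod_pos : sgraph :=
  @SGraph (Graph card_pos_ends)
    (fun v => vkind_of v.1)
    (fun e => match e with inl (e, _) => ekind_of e | inr _ => Hedge end).

End Pos.

Section Neg.
Variables (K : sgraph) (k : nat).

Let B : sgraph := prod_pos (sconj K) k.+1.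

(* The second summand holds the extra empty vertices: inl on the left, inr on
   the right.  The extra hedges are indexed in the same way. *)
Definition neg_vert : finType := (vert B + (vert K + vert K))%type.
Definition neg_edge : finType := (edge B + (vert K + vert K))%type.

Definition neg_ends (e : neg_edge) : {set neg_vert} :=
  match e with
  | inl e => [set inl v | v in ends e]
  | inr (inl v) => [set inr (inl v); inl (v, ord0)]
  | inr (inr v) => [set inr (inr v); inl (v, ord_max)]
  end.

Lemma card_neg_ends e : #|neg_ends e| = 2%N.
Proof.
case: e => [e|[v|v]] /=; try by rewrite cards2.
by rewrite card_imset ?card_pos_ends // => x y [].
Qed.

(* [prod_neg K k] is K x P_{-(k+1)}. *)
Definition prod_neg : sgraph :=
  @SGraph (Graph card_neg_ends)
    (fun v => match v with inl v => vkind_of v | inr _ => Empty end)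
    (fun e => match e with inl e => ekind_of e | inr _ => Hedge end).

End Neg.

Section Zero.
Variable K : sgraph.

Definition zero_vert : finType := (vert K * bool)%type.

Definition zero_ends (v : vert K) : {set zero_vert} :=
  [set (v, false); (v, true)].

Lemma card_zero_ends v : #|zero_ends v| = 2%N.
Proof. by rewrite cards2 xpair_eqE eqxx. Qed.

Definition prod_zero : sgraph :=
  @SGraph (Graph card_zero_ends) (fun=> Empty) (fun=> Hedge).

End Zero.

(* K x P_n; [Negz k] is -(k+1). *)
Definition prod_path (K : sgraph) (n : int) : sgraph :=
  match n with
  | Posz 0 => prod_zero K
  | Posz k.+1 => prod_pos K k.+1
  | Negz k => prod_neg K k
  end.

Definition rect (m : nat) (n : int) : sgraph :=
  prod_path (plain (path_graph m)) n.

Definition conj_rect (m : nat) (n : int) : sgraph :=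
  prod_path (sconj (plain (path_graph m))) n.

(* Main.v *)
Require Import Defs.
From mathcomp Require Import all_boot all_order all_algebra.

(** In K x P_{-k-2} every extra empty vertex lies on a single hedge, so every
    signed matching of nonzero weight contains all the extra hedges.  These
    hedges have weight 1 and cover both the empty vertices and the two extreme
    copies of K^*; what they leave free is exactly the k inner copies of K^*
    with the edges between them, that is K^* x P_k.  Hence
    M(K x P_{-k-2}) = M(K^* x P_k) for every signed graph K ([M_prod_neg]).
    The graph K x P_0 fits the same pattern: all its hedges are forced, and
    nothing is left, as in the product with an empty path ([M_prod_zero]).
    Both facts are instances of the deletion of a set of forced edges of
    weight 1 ([M_forced]).

    Taking K = G gives the theorem for n >= 0, and taking K = G^* (with
    G^** = G) gives it for n <= -2.  For n = -1 both sides are of the form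
    M(K x P_{-1}), where each vertex of K would have to be matched with two
    empty vertices at once: the value is 0 unless G has no vertex, in which
    case it is 1 ([M_prod_neg1]).  The rectangles are the case G = P_m. *)

Set Implicit Arguments.
Unset Strict Implicit.
Unset Printing Implicit Defensive.

Import GRing.Theory.
Local Open Scope ring_scope.

(** * Matchings and forced edges *)

Lemma matchingP (G : graph) (F : {set edge G}) :
  reflect (forall e f, e \in F -> f \in F -> e != f ->
             [disjoint ends e & ends f])
          (matching F).
Proof.
apply: (iffP forall_inP) => [mF e f eF fF | mF e eF].
  by move/forall_inP: (mF e eF) => /(_ f fF)/implyP.
by apply/forall_inP => f fF; apply/implyP; apply: mF.
Qed.

Lemma uncoveredP (G : graph) (F : {set edge G}) v :
  reflect (forall e, e \in F -> v \notin ends e) (v \in uncovered F).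
Proof. by rewrite inE; apply: forall_inP. Qed.

Lemma matching_inj (G : graph) (F : {set edge G}) e f v :
  matching F -> e \in F -> f \in F -> v \in ends e -> v \in ends f -> e = f.
Proof.
move=> /matchingP mF eF fF ve vf; apply/eqP/negPn/negP => /(mF _ _ eF fF).
by move/disjoint_setI0/setP/(_ v); rewrite !inE ve vf.
Qed.

Lemma weight_Empty (S : sgraph) (F : {set edge S}) v :
  weight F != 0 -> vkind_of v = Empty -> exists2 e, e \in F & v \in ends e.
Proof.
move=> wF vE; apply/exists_inP; apply: contraNT wF => /exists_inPn nF.
rewrite /weight (bigD1 v) /= ?vE ?mul0r ?mulr0 //.
by apply/uncoveredP.
Qed.

(** The hypotheses on phi and psi present S' as the subgraph of S induced on
    the vertices left free by H.  An edge of a matching that contains H is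
    either in H or avoids all the vertices covered by H, so these matchings are
    the unions of H with a matching of S', with the same uncovered vertices. *)
Lemma M_forced (S S' : sgraph) (H : {set edge S})
    (phi : vert S' -> vert S) (psi : edge S' -> edge S) :
  injective phi -> injective psi ->
  (forall e, ends (psi e) = phi @: ends e) ->
  (forall v, vkind_of (phi v) = vkind_of v) ->
  (forall e, ekind_of (psi e) = ekind_of e) ->
  uncovered H = phi @: setT ->
  (forall e, ends e \subset uncovered H -> e \in codom psi) ->
  matching H ->
  (forall e, e \in H -> eweight (ekind_of e) = 1) ->
  (forall F : {set edge S}, matching F -> weight F != 0 -> H \subset F) ->
  M S = M S'.
Proof.
move=> phiI psiI psiE vk ek freeH indH mH wH forced.
have psi_free e : ends (psi e) \subset uncovered H.
  by rewrite psiE freeH; apply: imsetS; apply: subsetT.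
have disjH h e : h \in H -> [disjoint ends h & ends (psi e)].
  move=> hH; rewrite disjoint_sym disjoint_subset.
  apply/subsetP => v /(subsetP (psi_free e))/uncoveredP.
  by move/(_ h hH); rewrite !inE.
have psiNH e : psi e \notin H.
  apply/negP => /(disjH _ e); rewrite -setI_eq0 setIid => /eqP e0.
  by have := card_ends (psi e); rewrite e0 cards0.
have matchU (F : {set edge S'}) : matching (H :|: psi @: F) = matching F.
  apply/matchingP/matchingP => mF e f.
    move=> eF fF ef; move: (mF (psi e) (psi f)).
    rewrite !inE !imset_f // !orbT inj_eq // !psiE => /(_ isT isT ef).
    by rewrite -!setI_eq0 -imsetI ?imset_eq0 // => x y _ _; apply: phiI.
  case/setUP=> [eH|/imsetP[e' e'F ->]]; case/setUP=> [fH|/imsetP[f' f'F ->]].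
  - by move/matchingP: mH; apply.
  - by move=> _; apply: disjH.
  - by move=> _; rewrite disjoint_sym; apply: disjH.
  - rewrite inj_eq // => /(mF _ _ e'F f'F); rewrite !psiE -!setI_eq0.
    by rewrite -imsetI ?imset_eq0 // => x y _ _; apply: phiI.
have freeU (F : {set edge S'}) :
    uncovered (H :|: psi @: F) = phi @: uncovered F.
  apply/setP => v; apply/uncoveredP/imsetP => [vF | [u /uncoveredP uF ->] e].
    have: v \in uncovered H.
      by apply/uncoveredP => e eH; apply: vF; rewrite inE eH.
    rewrite freeH => /imsetP[u _ vu]; exists u => //.
    apply/uncoveredP => e eF; have := vF (psi e).
    by rewrite inE imset_f // orbT psiE vu mem_imset // => /(_ isT).
  case/setUP=> [eH|/imsetP[e' e'F ->]]; last by rewrite psiE mem_imset ?uF.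
  have: phi u \in uncovered H by rewrite freeH imset_f.
  by move/uncoveredP; apply.
have weightU (F : {set edge S'}) : weight (H :|: psi @: F) = weight F.
  rewrite /weight freeU !big_imset /=; last by move=> x y _ _; apply: phiI.
  congr (_ * _); last by apply: eq_bigr => v _; rewrite vk.
  have disj : [disjoint H & psi @: F].
    rewrite disjoint_sym disjoint_subset; apply/subsetP => _ /imsetP[e _ ->].
    exact: psiNH.
  rewrite (eq_bigl (mem [predU H & psi @: F])) => [|e]; last by rewrite !inE.
  rewrite bigU //=.
  rewrite (eq_bigr _ wH) big1_eq mul1r big_imset /=.
    by apply: eq_bigr => e _; rewrite ek.
  by move=> e f _ _; apply: psiI.
rewrite /M (bigID (fun F : {set edge S} => H \subset F)) /=.
rewrite [X in _ + X]big1 ?addr0; last first.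
  by move=> F /andP[mF]; apply: contraNeq; apply: forced.
rewrite (reindex_onto (fun F' : {set edge S'} => H :|: psi @: F')
    (fun F => psi @^-1: F)) /=.
  apply: eq_big => [F | F _]; last exact: weightU.
  rewrite matchU subsetUl andbT; case: (matching F) => //=; apply/eqP/setP => e.
  by rewrite !inE (negPf (psiNH e)) mem_imset.
move=> F /andP[mF HF]; apply/setP => e; apply/setUP/idP.
  by case=> [/(subsetP HF) // | /imsetP[e' e'F ->]]; rewrite inE in e'F.
move=> eF; have [eH|eNH] := boolP (e \in H); [by left | right].
suff /codomP[e' ee] : e \in codom psi by rewrite ee imset_f // inE -ee.
apply: indH; apply/subsetP => v ve; apply/uncoveredP => h hH; apply/negP => vh.
move: eNH; rewrite (matching_inj mF eF (subsetP HF _ hH) ve vh).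
by rewrite hH.
Qed.

(** An edge has two ends, so there is no edge either, and only the empty
    matching is left. *)
Lemma M_novert (S : sgraph) : #|vert S| = 0%N -> M S = 1.
Proof.
move=> S0; have V0 (A : {set vert S}) : A = set0.
  by apply/eqP; rewrite -cards_eq0 -leqn0 -S0 max_card.
have E0 (F : {set edge S}) : F = set0.
  apply/setP => e; have := card_ends e; by rewrite (V0 (ends e)) cards0.
rewrite /M (big_pred1 set0) => [|F].
  by rewrite /weight (V0 (uncovered _)) !big_set0 mulr1.
have -> : pred1 set0 F by apply/eqP; apply: E0.
by apply/matchingP => e f; rewrite (E0 F) inE.
Qed.

(** * The product with an empty path *)

(** Every empty vertex of K x P_0 lies on a single hedge, so all hedges are
    forced. *)
Lemma M_prod_zero (K : sgraph) : M (prod_zero K) = M (prod_pos K 0).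
Proof.
have vt0 (v : vert (prod_pos K 0)) : False by case: v => ? [].
have et0 (e : edge (prod_pos K 0)) : False by case: e => [] [? []].
have free0 : uncovered (setT : {set edge (prod_zero K)}) = set0.
  apply/setP => -[v b]; rewrite in_set0; apply/negP => /uncoveredP/(_ v).
  by rewrite !inE !xpair_eqE eqxx; case: b => /(_ isT).
apply: (@M_forced _ _ setT (fun v => match vt0 v with end)
                           (fun e => match et0 e with end)).
- by move=> v; case: (vt0 v).
- by move=> e; case: (et0 e).
- by move=> e; case: (et0 e).
- by move=> v; case: (vt0 v).
- by move=> e; case: (et0 e).
- rewrite free0; apply/setP => v; rewrite in_set0; apply/esym/negP.
  by case/imsetP => u; case: (vt0 u).
- move=> e; rewrite free0 subset0 => /eqP e0.
  by have := card_ends e; rewrite e0 cards0.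
- apply/matchingP => u v _ _ uv; rewrite -setI_eq0; apply/eqP/setP => -[w b].
  rewrite !inE !xpair_eqE; apply/negP => /andP[].
  by case/orP => /andP[/eqP-> _]; rewrite (negPf uv).
- by [].
move=> F _ wF; apply/subsetP => v _.
have [//|u uF] := @weight_Empty (prod_zero K) _ (v, false) wF.
by rewrite !inE !xpair_eqE => /orP[] /andP[/eqP->].
Qed.

(** * Trimming the two extreme copies *)

Section Inner.
Variables (K : sgraph) (k : nat).

Lemma inner_subproof (i : 'I_k) : (i.+1 < k.+2)%N.
Proof. by rewrite ltnS ltnW // ltnS. Qed.

Definition inner (i : 'I_k) : 'I_k.+2 := Ordinal (inner_subproof i).

Lemma innerP (i : 'I_k.+2) :
  i != ord0 -> i != ord_max -> exists j, i = inner j.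
Proof.
rewrite -!val_eqE /=; case: i => [[|i] //= lti] _ neqi.
have ltik : (i < k)%N by rewrite -ltnS ltn_neqAle neqi -ltnS.
by exists (Ordinal ltik); apply: val_inj.
Qed.

Lemma inner_edge_subproof (i : 'I_k.-1) : (i.+1 < k.+2.-1)%N.
Proof. by case: k i => [[]|k' i] //=; rewrite ltnS ltnW // ltnS. Qed.

Definition inner_edge (i : edge (path_graph k)) : edge (path_graph k.+2) :=
  Ordinal (inner_edge_subproof i).

Lemma ends_inner_edge f :
  ends (inner_edge f) = inner @: ends f.
Proof.
apply/setP => i; rewrite inE /=; apply/idP/imsetP.
  move=> fi; have ltf : (f.+1 < k)%N by rewrite -ltn_predRL.
  have [|| j ij] := @innerP i.
  - by apply: contraTneq fi => ->.
  - apply: contraTneq fi => -> /=.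
    by rewrite !eqSS !gtn_eqF // ltnW.
  by exists j; rewrite // inE; move: fi; rewrite ij /= !eqSS.
by case=> j; rewrite inE => fj ->; rewrite /= !eqSS.
Qed.

Lemma inner_edgeP (f : edge (path_graph k.+2)) :
  ends f \subset inner @: setT -> exists g, f = inner_edge g.
Proof.
move=> /subsetP sub.
have ltf : (f.+1 < k.+2)%N by rewrite ltnS.
have /sub/imsetP[i _ fi] : Ordinal (ltnW ltf) \in ends f by rewrite inE /= eqxx.
have /sub/imsetP[j _ fj] : Ordinal ltf \in ends f by rewrite inE /= eqxx orbT.
have {}fi : f = i.+1 :> nat by have := congr1 val fi.
have {}fj : f = j :> nat by have := congr1 val fj => -[].
have lti : (i < k.-1)%N by rewrite ltn_predRL -fi fj.
by exists (Ordinal lti); apply: val_inj.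
Qed.

Notation S := (prod_neg K k.+1).
Notation S' := (prod_pos (sconj K) k).

Definition inner_vert (v : vert S') : vert S := inl (v.1, inner v.2).

Definition inner_pos_edge (e : edge S') : edge S :=
  match e with
  | inl (e, i) => inl (inl (e, inner i))
  | inr (v, f) => inl (inr (v, inner_edge f))
  end.

Definition outer_hedges : {set edge S} :=
  [set e | if e is inr _ then true else false].

Lemma uncovered_outer : uncovered outer_hedges = inner_vert @: setT.
Proof.
apply/setP => v; apply/uncoveredP/imsetP => [vF | [[u i] _ ->] e].
  have vL u : v \notin ends (inr (inl u) : edge S) by apply: vF; rewrite inE.
  have vR u : v \notin ends (inr (inr u) : edge S) by apply: vF; rewrite inE.
  case: v vL vR {vF} => [[v i]|[v|v]] vL vR.
  - have [||j ij] := @innerP i.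
    + by apply: contraNneq (vL v) => ->; rewrite !inE eqxx orbT.
    + by apply: contraNneq (vR v) => ->; rewrite !inE eqxx orbT.
    by exists (v, j); rewrite ?inE // ij.
  - by have := vL v; rewrite !inE eqxx.
  - by have := vR v; rewrite !inE eqxx.
rewrite inE; case: e => // -[] w _; rewrite !inE /=; apply/eqP => -[_] //.
by case=> ik; have := ltn_ord i; rewrite ik ltnn.
Qed.

(** An edge of the product lies in a single copy, or joins two images of one
    vertex; so it is inner as soon as its endpoints lie in inner copies. *)
Lemma free_edge_inner e : ends e \subset uncovered outer_hedges ->
  e \in codom inner_pos_edge.
Proof.
rewrite uncovered_outer => sub.
have inP u (i : 'I_k.+2) : (inl (u, i) : vert S) \in inner_vert @: setT ->
    i \in inner @: setT.
  by case/imsetP => -[w j] _ [_ ->]; rewrite imset_f.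
case: e sub => [[[e i]|[v f]]|[v|v]] /subsetP sub.
- have : #|ends e| != 0%N by rewrite card_ends.
  rewrite cards_eq0 => /set0Pn[v ve].
  have /sub/inP/imsetP[j _ ->] :
      (inl (v, i) : vert S) \in ends (inl (inl (e, i)) : edge S).
    by rewrite imset_f // imset_f.
  by apply/codomP; exists (inl (e, j)).
- have [|g ->] := @inner_edgeP f; last by apply/codomP; exists (inr (v, g)).
  apply/subsetP => i fi; apply: (inP v); apply: sub.
  by rewrite imset_f // imset_f.
- have /sub/imsetP[] // :
      (inr (inl v) : vert S) \in ends (inr (inl v) : edge S).
  by rewrite !inE eqxx.
- have /sub/imsetP[] // :
      (inr (inr v) : vert S) \in ends (inr (inr v) : edge S).
  by rewrite !inE eqxx.
Qed.

Lemma matching_outer : matching outer_hedges.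
Proof.
apply/matchingP => -[?|[v|v]] [?|[w|w]]; rewrite !inE // => _ _ vw;
  apply/pred0P => x; apply/andP; rewrite !inE => -[/orP[]/eqP->];
  by case/orP => /eqP[] // evw; rewrite evw eqxx in vw.
Qed.

End Inner.

(** * Negative products *)

(** An extra empty vertex lies on no edge but its own hedge, and must be
    covered. *)
Lemma empty_left (K : sgraph) k (F : {set edge (prod_neg K k)}) v :
  weight F != 0 -> inr (inl v) \in F.
Proof.
move=> wF; have [//|e eF] := @weight_Empty (prod_neg K k) _ (inr (inl v)) wF.
case: e eF => [e|[w|w]] eF; rewrite ?inE //=.
  by case/imsetP.
by rewrite orbF => /eqP[->].
Qed.

Lemma empty_right (K : sgraph) k (F : {set edge (prod_neg K k)}) v :
  weight F != 0 -> inr (inr v) \in F.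
Proof.
move=> wF; have [//|e eF] := @weight_Empty (prod_neg K k) _ (inr (inr v)) wF.
case: e eF => [e|[w|w]] eF; rewrite ?inE //=.
  by case/imsetP.
by rewrite orbF => /eqP[->].
Qed.

Lemma M_prod_neg (K : sgraph) k :
  M (prod_neg K k.+1) = M (prod_path (sconj K) k).
Proof.
(* With prod_pos of length 0 in place of prod_zero, k = 0 is no exception. *)
transitivity (M (prod_pos (sconj K) k)); last first.
  by case: k => //=; rewrite M_prod_zero.
apply: (@M_forced _ _ (outer_hedges K k)
          (@inner_vert K k) (@inner_pos_edge K k)).
- by move=> [u i] [v j] [-> /val_inj->].
- move=> [[e i]|[v i]] [[f j]|[w j]] //= [->] ij; do 2!congr (_ _).
    exact: val_inj.
  exact: val_inj.
- case=> [[e i]|[v f]] /=.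
    by rewrite -!imset_comp.
  by rewrite [path_ends _]ends_inner_edge -!imset_comp.
- by case.
- by case=> -[].
- exact: uncovered_outer.
- exact: free_edge_inner.
- exact: matching_outer.
- by case=> [?|?]; rewrite inE.
move=> F _ wF; apply/subsetP => -[?|[v|v]]; rewrite inE // => _.
  exact: empty_left.
exact: empty_right.
Qed.

(** In K x P_{-1} the leftmost and the rightmost copy coincide, so the two
    hedges forced at a vertex of K meet: there is no matching of nonzero weight
    unless K has no vertex. *)
Lemma M_prod_neg1 (K : sgraph) : M (prod_neg K 0) = (#|vert K| == 0%N)%:R.
Proof.
have [K0|] := eqVneq #|vert K| 0%N.
  by apply: M_novert; rewrite !card_sum card_prod K0.
rewrite -lt0n => /card_gt0P[v _]; apply: big1 => F mF.
apply/eqP/negPn/negP => wF.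
suff: (inr (inl v) : edge (prod_neg K 0)) = inr (inr v) by [].
apply: (@matching_inj _ F _ _ (inl (v, ord0)) mF).
- exact: empty_left.
- exact: empty_right.
- by rewrite !inE eqxx orbT.
- by rewrite (_ : ord0 = ord_max) ?set22 //; apply: val_inj.
Qed.

(** The cases n <= -2 are the cases n >= 0 read from right to left, with G^* for
    G; G^** is convertible to G because the kinds of the vertices and edges of a
    plain graph are constant. *)
Lemma M_prod_path (G : graph) (n : int) :
  M (prod_path (plain G) (- n - 2)) = M (prod_path (sconj (plain G)) n).
Proof.
case: n => [k|[|[|k]]].
- have -> : (- k%:Z - 2 = Negz k.+1) by rewrite NegzE -[k.+2]addn2 -opprD.
  exact: M_prod_neg.
- by rewrite [- _ - _]/= !M_prod_neg1.
- by rewrite [- _ - _]/= [RHS](M_prod_neg _ 0).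
have -> : - Negz k.+2 - 2 = k.+1.
  by rewrite NegzE opprK -[k.+3]addn2 PoszD addrK.
by rewrite [RHS](M_prod_neg _ k.+1).
Qed.

Close Scope ring_scope.

Theorem theorem2 :
  (forall (G : graph) (n : int),
     M (prod_path (plain G) (- n - 2)%R) = M (prod_path (sconj (plain G)) n)) /\
  (forall (m : nat) (n : int), 1 <= m ->
     M (rect m (- n - 2)%R) = M (conj_rect m n)).
Proof.
by split=> [G n | m n _]; apply: M_prod_path.
Qed.
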